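(* Every finite subset of $\hat{\mathbb{C}}$ is the Julia set $\mathscr{J}(\boldsymbol{q})$ of some sequence of polynomials $\boldsymbol{q}=(q_n)_{n\ge1}$. In particular, finite Julia sets of arbitrary cardinality can occur.
   Context: $\hat{\mathbb{C}}=\mathbb{C}\cup\{\infty\}$ is the Riemann sphere with the spherical metric $\sigma$. For a sequence $\boldsymbol{f}=(f_n)_{n\ge1}$ of rational maps of $\hat{\mathbb{C}}$, put $F^{(n)}_{\boldsymbol{f}}:=f_n\circ\dots\circ f_1$. The Fatou set $\mathscr{F}(\boldsymbol{f})$ is the largest open subset of $\hat{\mathbb{C}}$ on which the family $\{F^{(n)}_{\boldsymbol{f}} : n\ge1\}$ is normal (every sequence in the family has a subsequence converging locally uniformly, with respect to $\sigma$, to a holomorphic map into $\hat{\mathbb{C}}$), and the Julia set is $\mathscr{J}(\boldsymbol{f}):=\hat{\mathbb{C}}\setminus\mathscr{F}(\boldsymbol{f})$. *)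

(* Defs.v *)
From HB Require Import structures.
From mathcomp Require Import all_boot all_order all_algebra.
From mathcomp Require Import complex.
From mathcomp Require Import all_classical all_reals all_analysis.
From mathcomp Require Import ring lra.

Set Implicit Arguments.
Unset Strict Implicit.
Unset Printing Implicit Defensive.

Import Order.TTheory GRing.Theory Num.Theory numFieldNormedType.Exports.

Local Open Scope classical_set_scope.
Local Open Scope ring_scope.
Local Open Scope complex_scope.

(* [None] is the point at infinity. *)
Definition sphere (R : realType) : Type := option R[i].

HB.instance Definition _ (R : realType) := Choice.on (sphere R).

Section SphericalMetric.
Variable R : realType.
Implicit Types (x y z : sphere R) (u v w : R * R * R).

(* Inverse stereographic projection onto the unit sphere of R^3, from the
   north pole (0, 0, 1). *)
Definition stereo x : R * R * R :=
  if x is Some (a +i* b) then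
    let s := a ^+ 2 + b ^+ 2 in
    (2 * a / (s + 1), 2 * b / (s + 1), (s - 1) / (s + 1))
  else (0, 0, 1).

Definition dot3 u v : R := u.1.1 * v.1.1 + u.1.2 * v.1.2 + u.2 * v.2.

(* The spherical metric is the great-circle distance on the unit sphere. *)
Definition sigma x y : R := acos (dot3 (stereo x) (stereo y)).

Lemma dot3C u v : dot3 u v = dot3 v u.
Proof. by rewrite /dot3; ring. Qed.

Lemma stereo_unit x : dot3 (stereo x) (stereo x) = 1.
Proof.
case: x => [[a b]|]; last by rewrite /dot3 /=; ring.
rewrite /dot3 /=; have : a ^+ 2 + b ^+ 2 + 1 != 0; last by move=> ?; field.
by rewrite gt_eqF // ltr_wpDl // addr_ge0 ?sqr_ge0.
Qed.

Lemma stereo_inj : injective stereo.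
Proof.
have pos (a b : R) : 0 < a ^+ 2 + b ^+ 2 + 1.
  by rewrite ltr_wpDl // addr_ge0 ?sqr_ge0.
have third (a b : R) : (a ^+ 2 + b ^+ 2 - 1) / (a ^+ 2 + b ^+ 2 + 1) =
    1 - 2 / (a ^+ 2 + b ^+ 2 + 1).
  by have /gt_eqF/negbT := pos a b => ?; field.
have ninf (a b : R) : 1 - 2 / (a ^+ 2 + b ^+ 2 + 1) <> 1.
  have : 0 < 2 / (a ^+ 2 + b ^+ 2 + 1) by rewrite divr_gt0.
  by move=> ? ?; lra.
case=> [[a b]|] [[c d]|] //=; rewrite ?third.
- case=> e1 e2 e3.
  have i_eq : (a ^+ 2 + b ^+ 2 + 1)^-1 = (c ^+ 2 + d ^+ 2 + 1)^-1 by lra.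
  have i_neq0 : (c ^+ 2 + d ^+ 2 + 1)^-1 != 0.
    by rewrite invr_eq0 gt_eqF.
  move: e1 e2; rewrite i_eq => /(mulIf i_neq0) e1 /(mulIf i_neq0) e2.
  have -> : a = c by lra.
  by have -> : b = d by lra.
- by case=> _ _ /ninf.
- by case=> _ _ /esym/ninf.
Qed.

Lemma dot3_bound u v : dot3 u u = 1 -> dot3 v v = 1 -> -1 <= dot3 u v <= 1.
Proof.
case: u v => [[u1 u2] u3] [[v1 v2] v3]; rewrite /dot3 /= => hu hv.
have := sqr_ge0 (u1 - v1); have := sqr_ge0 (u2 - v2).
have := sqr_ge0 (u3 - v3); have := sqr_ge0 (u1 + v1).
have := sqr_ge0 (u2 + v2); have := sqr_ge0 (u3 + v3).
rewrite !expr2 => h1 h2 h3 h4 h5 h6; apply/andP; split; lra.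
Qed.

(* Nonnegativity of the Gram determinant of three unit vectors. *)
Lemma gram3_ge0 u v w : dot3 u u = 1 -> dot3 v v = 1 -> dot3 w w = 1 ->
  (dot3 u v * dot3 v w - dot3 u w) ^+ 2 <=
    (1 - dot3 u v ^+ 2) * (1 - dot3 v w ^+ 2).
Proof.
move=> hu hv hw; rewrite -subr_ge0.
pose D := u.1.1 * (v.1.2 * w.2 - v.2 * w.1.2)
        - u.1.2 * (v.1.1 * w.2 - v.2 * w.1.1)
        + u.2 * (v.1.1 * w.1.2 - v.1.2 * w.1.1).
suff -> : (1 - dot3 u v ^+ 2) * (1 - dot3 v w ^+ 2)
    - (dot3 u v * dot3 v w - dot3 u w) ^+ 2 = D ^+ 2 by apply: sqr_ge0.
transitivity (dot3 u u * dot3 v v * dot3 w w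
    + 2 * dot3 u v * dot3 v w * dot3 u w - dot3 u u * dot3 v w ^+ 2
    - dot3 v v * dot3 u w ^+ 2 - dot3 w w * dot3 u v ^+ 2).
  by rewrite hu hv hw; ring.
by rewrite /D /dot3; ring.
Qed.

Lemma dot3_stereo_bound x y : -1 <= dot3 (stereo x) (stereo y) <= 1.
Proof. by apply: dot3_bound; apply: stereo_unit. Qed.

Lemma sigma_xx x : sigma x x = 0.
Proof. by rewrite /sigma stereo_unit acos1. Qed.

Lemma sigma_sym x y : sigma x y = sigma y x.
Proof. by rewrite /sigma dot3C. Qed.

Lemma sigma_eq0 x y : sigma x y = 0 -> x = y.
Proof.
move=> /(congr1 cos); rewrite cos0 acosK ?in_itv /= ?dot3_stereo_bound //.
move=> h; apply: stereo_inj; move: h (stereo_unit x) (stereo_unit y).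
case: (stereo x) (stereo y) => [[u1 u2] u3] [[v1 v2] v3]; rewrite /dot3 /=.
move=> h hu hv.
have : (u1 - v1) ^+ 2 + (u2 - v2) ^+ 2 + (u3 - v3) ^+ 2 = 0.
  by rewrite !expr2; lra.
move/eqP; rewrite paddr_eq0 ?addr_ge0 ?sqr_ge0 // => /andP[].
rewrite paddr_eq0 ?sqr_ge0 // => /andP[].
by rewrite !sqrf_eq0 !subr_eq0 => /eqP-> /eqP-> /eqP->.
Qed.

Lemma sigma_triangle y x z : sigma x z <= sigma x y + sigma y z.
Proof.
have bxy := dot3_stereo_bound x y; have byz := dot3_stereo_bound y z.
have bxz := dot3_stereo_bound x z.
have [hpi|hpi] := leP pi (sigma x y + sigma y z).
  by apply: le_trans hpi; apply: acos_lepi.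
have h0 : 0 <= sigma x y + sigma y z by rewrite addr_ge0 // acos_ge0.
rewrite leNgt; apply/negP => hlt.
have : cos (sigma x z) < cos (sigma x y + sigma y z).
  by rewrite ltr_cos // in_itv /= ?h0 ?(ltW hpi) // acos_ge0 // acos_lepi.
rewrite cosD !acosK ?in_itv //= !sin_acos // -sqrtrM; last first.
  by move: bxy => /andP[? ?]; nra.
have := gram3_ge0 (stereo_unit x) (stereo_unit y) (stereo_unit z).
rewrite -ler_sqrt ?sqrtr_sqr; last first.
  by apply: mulr_ge0; [move: bxy|move: byz] => /andP[? ?]; nra.
by move=> /(le_trans (ler_norm _)) ? ?; lra.
Qed.

HB.instance Definition _ := isMetric.Build R (sphere R)
  sigma_xx sigma_eq0 sigma_sym sigma_triangle.

End SphericalMetric.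

Section Dynamics.
Variable R : realType.
Local Notation S := (sphere R).

(* The map z |-> 1/z, a coordinate chart around infinity. *)
Definition inversion (x : S) : S :=
  match x with
  | Some z => if z == 0 then None else Some z^-1
  | None => Some 0
  end.

(* The standard coordinate chart around [p], and also its inverse. *)
Definition chart (p x : S) : S := if p is Some _ then x else inversion x.

(* The value 0 at infinity is irrelevant in [holomorphic_at]: by continuity
   the expression under the derivative is finite near the base point. *)
Definition finite_part (x : S) : R[i] := odflt 0 x.

(* Continuity together with complex differentiability in local coordinates.
   As [R[i]] is the field of scalars, derivability in the direction 1 is
   complex differentiability. *)
Definition holomorphic_at (g : S -> S) (p : S) : Prop :=
  {for p, continuous g} /\
  derivable (fun w : R[i]^o =>
    finite_part (chart (g p) (g (chart p (Some w)))) : R[i]^o)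
    (finite_part (chart p p)) 1.

Definition holomorphic_on (U : set S) (g : S -> S) : Prop :=
  forall p, U p -> holomorphic_at g p.

Definition locally_uniform_cvg (U : set S) (g : nat -> S -> S) (h : S -> S) :
    Prop :=
  forall p, U p -> exists2 V, nbhs p V & {uniform U `&` V, g @ \oo --> h}.

Definition normal_on (U : set S) (A : set (S -> S)) : Prop :=
  forall g : nat -> S -> S, (forall k, A (g k)) ->
  exists phi : nat -> nat, increasing_seq phi /\
  exists h : S -> S, holomorphic_on U h /\
    locally_uniform_cvg U (g \o phi) h.

(* Sequences of maps are indexed from 1; the value [f 0] is not used. *)
Fixpoint iterate (f : nat -> S -> S) (n : nat) : S -> S :=
  if n is m.+1 then f n \o iterate f m else id.

Definition iterates (f : nat -> S -> S) : set (S -> S) :=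
  [set iterate f n | n in [set n | (0 < n)%N]].

Definition is_fatou_set (f : nat -> S -> S) (U : set S) : Prop :=
  [/\ open U, normal_on U (iterates f) &
      forall V, open V -> normal_on V (iterates f) -> V `<=` U].

Definition is_julia_set (f : nat -> S -> S) (J : set S) : Prop :=
  exists2 U, is_fatou_set f U & J = ~` U.

Definition poly_map (p : {poly R[i]}) (x : S) : S :=
  match x with
  | Some z => Some p.[z]
  | None => if (size p <= 1)%N then Some p`_0 else None
  end.

End Dynamics.

(* Main.v *)
(* Compositions of the form [F_n = 2^(t n) Q], with [Q] a fixed nonconstant
   polynomial and [t] a sequence of integers, are obtained from [q_1 = 2^(t 1) Q]
   and the linear maps [q_n = 2^(t n - t (n-1)) X].  A sequence of integers has a
   subsequence that is constant or tends to +oo or to -oo; in the last two cases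
   [F_n] tends to infinity locally uniformly off the zeros of [Q], respectively
   to 0 locally uniformly off infinity, while [F_n] fixes the value 0 at the
   zeros and infinity at infinity.  So the zeros of [Q] lie in the Julia set
   exactly when [t] is unbounded above, infinity exactly when [t] is unbounded
   below, and no other point does.  The distance is handled in its chordal form,
   for which [z |-> 1/z] is an isometry. *)

Require Import Defs.
From mathcomp Require Import all_boot all_order all_algebra.
From mathcomp Require Import complex.
From mathcomp Require Import all_classical all_reals all_analysis.
From mathcomp Require Import ring lra zify.

Set Implicit Arguments.
Unset Strict Implicit.
Unset Printing Implicit Defensive.

Import Order.TTheory GRing.Theory Num.Theory numFieldNormedType.Exports.

Local Open Scope classical_set_scope.
Local Open Scope ring_scope.
Local Open Scope complex_scope.

Section Sphere.
Variable R : realType.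
Local Notation S := (sphere R).
Local Notation C := (R[i]^o).
Implicit Types (x y p : S) (z w : R[i]).

(** * Squared modulus and neighbourhoods in the plane *)

Definition normsq z : R := complex.Re z ^+ 2 + complex.Im z ^+ 2.

Lemma normsq_ge0 z : 0 <= normsq z.
Proof. by rewrite addr_ge0 ?sqr_ge0. Qed.

Lemma normsqE z : (normsq z)%:C = `|z| ^+ 2.
Proof. exact: add_Re2_Im2. Qed.

Lemma normsqM z w : normsq (z * w) = normsq z * normsq w.
Proof. by case: z w => [a b] [c d]; rewrite /normsq /=; ring. Qed.

Lemma normsq1 : normsq 1 = 1.
Proof. by rewrite /normsq /=; ring. Qed.

Lemma normsq_eq0 z : (normsq z == 0) = (z == 0).
Proof. by rewrite -(inj_eq (@complexI R)) normsqE sqrf_eq0 normr_eq0. Qed.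

Lemma normsqV z : normsq z^-1 = (normsq z)^-1.
Proof.
have [->|z0] := eqVneq z 0.
  by rewrite invr0 /normsq /= !expr0n /= addr0 invr0.
have n0 : normsq z != 0 by rewrite normsq_eq0.
by apply: (mulIf n0); rewrite -normsqM !mulVf // normsq1.
Qed.

(** Radii of balls in [C] are elements of [R[i]], whose order makes every positive element real;
    squaring moves all later estimates into [R]. *)
Lemma nbhs_normsq (z : C) (A : set C) :
  nbhs z A <-> exists2 d : R, 0 < d & forall w, normsq (w - z) < d -> A w.
Proof.
split.
  move=> /nbhs_ballP[[e e'] /=]; rewrite ltcE /= => /andP[/eqP -> e0] zA.
  exists (e ^+ 2); first by rewrite exprn_gt0.
  move=> w h; apply: zA; rewrite /ball /= distrC.
  rewrite -(@ltr_pXn2r _ 2) ?nnegrE ?normr_ge0 ?lecR ?(ltW e0) //.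
  by rewrite -normsqE (_ : (e +i* 0) ^+ 2 = (e ^+ 2)%:C) ?ltcR // rmorphXn.
case=> d d0 zA; apply/nbhs_ballP; exists (Num.sqrt d)%:C.
  by rewrite /= ltcR sqrtr_gt0.
move=> w; rewrite /ball /= distrC => h; apply: zA.
rewrite -ltcR normsqE -[d]sqr_sqrtr ?(ltW d0) // rmorphXn /=.
by rewrite ltr_pXn2r ?nnegrE ?normr_ge0 // lecR sqrtr_ge0.
Qed.

(** * The distance in chordal form *)

(* Half of the squared chordal distance. *)
Definition chordal x y : R := 1 - dot3 (stereo x) (stereo y).

Lemma chordal_ge0 x y : 0 <= chordal x y.
Proof. by rewrite subr_ge0; have /andP[] := dot3_stereo_bound x y. Qed.

Lemma chordal_sym x y : chordal x y = chordal y x.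
Proof. by rewrite /chordal dot3C. Qed.

Lemma chordal_eq0 x y : chordal x y = 0 -> x = y.
Proof.
move=> /eqP; rewrite subr_eq0 => /eqP h; apply: sigma_eq0.
by rewrite /sigma -h acos1.
Qed.

Let normsqS_neq0 (a b : R) : a ^+ 2 + b ^+ 2 + 1 != 0.
Proof. by rewrite gt_eqF // ltr_wpDl // addr_ge0 ?sqr_ge0. Qed.

Lemma chordal_fin z w : chordal (Some z) (Some w) =
  2 * normsq (z - w) / ((normsq z + 1) * (normsq w + 1)).
Proof.
case: z w => [a b] [c d]; rewrite /chordal /dot3 /normsq /=.
have := normsqS_neq0 a b; have := normsqS_neq0 c d => ? ?.
by field; apply/andP.
Qed.

Lemma chordal_inf z : chordal (Some z) None = 2 / (normsq z + 1).
Proof.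
case: z => [a b]; rewrite /chordal /dot3 /normsq /=.
by have := normsqS_neq0 a b => ?; field.
Qed.

(** On the unit sphere 1/z is the half-turn about the first axis, hence an isometry; the explicit
    formulas confirm it case by case. *)
Lemma chordal_inversion x y : chordal (inversion x) (inversion y) = chordal x y.
Proof.
have S0 z : z != 0 -> normsq z != 0 by rewrite normsq_eq0.
have n0 : normsq 0 = 0 by rewrite /normsq /= !expr0n addr0.
have S1 z : normsq z + 1 != 0 by rewrite gt_eqF // ltr_wpDl // normsq_ge0.
have hinf z : chordal (inversion (Some z)) (inversion None) = chordal (Some z) None.
  rewrite /=; case: eqVneq => [->|z0].
    by rewrite chordal_sym !chordal_inf.
  rewrite chordal_fin chordal_inf subr0 normsqV n0.
  by have := S0 _ z0; have := S1 z => ? ?; field;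
    rewrite ?[1 + _]addrC; do ?[apply/andP; split].
case: x y => [z|] [w|]; [|exact: hinf|by rewrite chordal_sym hinf chordal_sym|].
  rewrite /=; case: eqVneq => [->|z0]; case: eqVneq => [->|w0].
  - by rewrite /chordal !stereo_unit.
  - rewrite chordal_sym chordal_inf chordal_fin sub0r normsqV n0 -mulN1r normsqM.
    rewrite (_ : normsq (-1) = 1); last by rewrite /normsq /=; ring.
    by have := S0 _ w0; have := S1 w => ? ?; field;
      rewrite ?[1 + _]addrC; do ?[apply/andP; split].
  - rewrite chordal_inf chordal_fin subr0 normsqV n0.
    by have := S0 _ z0; have := S1 z => ? ?; field;
      rewrite ?[1 + _]addrC; do ?[apply/andP; split].
  rewrite !chordal_fin.
  rewrite (_ : z^-1 - w^-1 = (w - z) * z^-1 * w^-1); last by field; apply/andP.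
  rewrite !normsqM -[w - z]opprB -[- (z - w)]mulN1r normsqM !normsqV.
  rewrite (_ : normsq (-1) = 1); last by rewrite /normsq /=; ring.
  have := S0 _ w0; have := S1 w; have := S0 _ z0; have := S1 z => ? ? ? ?.
  by field; rewrite ?[1 + _]addrC; do ?[apply/andP; split].
by rewrite /chordal !stereo_unit.
Qed.

(** Since [chordal] is one minus the cosine of [sigma] and cosine decreases on [0, pi], small values
    correspond; the minimum with [pi] keeps the bound in that interval. *)
Lemma chordal_sigma (e : R) : 0 < e ->
  exists2 d : R, 0 < d & forall x y, chordal x y < d -> sigma x y < e.
Proof.
move=> e0; pose m := Order.min e pi.
have m0 : 0 < m by rewrite lt_min e0 pi_gt0.
have mpi : m <= pi by rewrite ge_min lexx orbT.
exists (1 - cos m).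
  by rewrite subr_gt0 -[X in _ < X]cos0 ltr_cos ?in_itv //= ?lexx ?pi_ge0 ?mpi ?(ltW m0).
move=> x y; rewrite /chordal ltrD2l ltrN2 => h.
suff : sigma x y < m by move=> /lt_le_trans -> //; rewrite ge_min lexx.
have b := dot3_stereo_bound x y.
rewrite -ltr_cos ?in_itv /= ?mpi ?(ltW m0) ?acos_ge0 ?acos_lepi //.
by rewrite acosK // in_itv.
Qed.

Lemma sigma_chordal (d : R) : 0 < d ->
  exists2 e : R, 0 < e & forall x y, sigma x y < e -> chordal x y < d.
Proof.
(* Capping at 1 keeps [1 - m] in the domain of [acos]. *)
move=> d0; pose m := Order.min d 1.
have m0 : 0 < m by rewrite lt_min d0 ltr01.
have m1 : m <= 1 by rewrite ge_min lexx orbT.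
have mb : -1 <= 1 - m <= 1 by apply/andP; split; lra.
have ab : 0 <= acos (1 - m) <= pi by rewrite acos_ge0 // acos_lepi.
exists (acos (1 - m)).
  rewrite -ltr_cos ?in_itv /= ?lexx ?pi_ge0 // cos0 acosK ?in_itv //=.
  by rewrite ltrBlDr ltrDl.
move=> x y; have b := dot3_stereo_bound x y.
rewrite -ltr_cos ?in_itv /= ?acos_ge0 ?acos_lepi // !acosK ?in_itv //.
have : m <= d by rewrite ge_min lexx.
by rewrite /chordal /=; lra.
Qed.

Lemma nbhs_chordal p (A : set S) :
  nbhs p A <-> exists2 d : R, 0 < d & forall x, chordal p x < d -> A x.
Proof.
split.
  move=> /nbhs_ballP[e /= /chordal_sigma[d d0 h] eA]; exists d => // x /h.
  exact: eA.
case=> d /sigma_chordal[e e0 h] dA; apply/nbhs_ballP; exists e => // x /h.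
exact: dA.
Qed.

(** * Charts and the topology of the sphere *)

Lemma inversionK : involutive (@inversion R).
Proof.
case=> [z|] /=; last by rewrite eqxx.
by case: (eqVneq z 0) => [->|z0] //=; rewrite invr_eq0 (negbTE z0) invrK.
Qed.

Lemma inversion_continuous : continuous (@inversion R).
Proof.
move=> p A /nbhs_chordal[d d0 dA]; apply/nbhs_chordal; exists d => // x h.
by apply: dA; rewrite chordal_inversion.
Qed.

Lemma chart_continuous p : continuous (chart p).
Proof. by case: p => [z|]; [move=> x; exact: cvg_id|exact: inversion_continuous]. Qed.

Lemma chartK p : involutive (chart p).
Proof. by case: p => // z; apply: inversionK. Qed.

Lemma chart_finite p : chart p p = Some (finite_part (chart p p)).
Proof. by case: p. Qed.

Lemma Some_continuous : continuous (Some : C -> S).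
Proof.
move=> z A /nbhs_chordal[d d0 dA]; apply/nbhs_normsq; exists (d / 2).
  by rewrite divr_gt0.
move=> w h; apply: dA; rewrite chordal_sym chordal_fin ltr_pdivrMr; last first.
  by rewrite mulr_gt0 // ltr_wpDl // normsq_ge0.
have zw : 1 <= (normsq w + 1) * (normsq z + 1).
  by have := normsq_ge0 z; have := normsq_ge0 w; nra.
have : d <= d * ((normsq w + 1) * (normsq z + 1)) by rewrite ler_pMr.
by lra.
Qed.

Lemma nbhs_Some (z : C) (A : set S) : nbhs (Some z : S) A <-> nbhs z (Some @^-1` A).
Proof.
split; first exact: Some_continuous.
move=> /nbhs_normsq[d d0 dA]; apply/nbhs_chordal.
set s := normsq z + 1; have s0 : 0 < s by rewrite ltr_wpDl // normsq_ge0.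
(* If [normsq (w - z) >= d], then [normsq w + 1] is at most a constant times
   [normsq (w - z)]. *)
pose m := 2 + 2 * s / d.
have m0 : 0 < m by rewrite addr_gt0 // divr_gt0 // mulr_gt0.
(* As [m > 1], this radius is below the chordal distance [2 / s] from [Some z] to infinity, which
   excludes infinity; for finite [w] it yields [n * m < normsq w + 1]. *)
exists (2 / (s * m)); first by rewrite divr_gt0 // mulr_gt0.
have small x : chordal (Some z) x < 2 / (s * m) ->
      exists2 w, x = Some w & normsq (w - z) < d.
  have md : m * d = 2 * d + 2 * s by rewrite /m mulrDl divfK ?gt_eqF.
  case: x => [w|]; last first.
    rewrite chordal_inf -/s ltr_pM2l // ltf_pV2 ?posrE ?mulr_gt0 // gtr_pMr //.
    have : 0 < 2 * s / d by rewrite divr_gt0 // mulr_gt0.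
    by rewrite /m => *; exfalso; lra.
  move=> h; exists w => //; move: h; rewrite chordal_sym chordal_fin -/s.
  set n := normsq (w - z); have n0 : 0 <= n := normsq_ge0 _.
  have w0 : 0 < normsq w + 1 by rewrite ltr_wpDl // normsq_ge0.
  rewrite ltr_pdivrMr ?mulr_gt0 // mulrAC ltr_pdivlMr ?mulr_gt0 // => h.
  have {}h : n * m < normsq w + 1 by nra.
  have wle : normsq w <= 2 * n + 2 * normsq z.
    rewrite /n; case: (w) (z) => [a b] [a' b']; rewrite /normsq /=.
    have := sqr_ge0 (a - 2 * a'); have := sqr_ge0 (b - 2 * b'); nra.
  rewrite ltNge; apply/negP => dn.
  have : n * (2 * s / d) >= 2 * s.
    by rewrite mulrA ler_pdivlMr //; nra.
  by move: h wle; rewrite /m mulrDr /s => *; have := normsq_ge0 z; lra.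
by move=> x /small[w -> /dA].
Qed.

(** * Holomorphy in local coordinates *)

(** Charts are continuous involutions, so [g] inherits continuity from [h], and only the derivative
    of one explicit function remains to be found. *)
Lemma holomorphic_at_chart (g : S -> S) p (h : C -> C) :
  let w0 : C := finite_part (chart p p) in
  derivable h w0 1 ->
  (\forall w \near w0, chart (g p) (g (chart p (Some w))) = Some (h w)) ->
  holomorphic_at g p.
Proof.
move=> w0 dh gh; have hc : {for w0, continuous h}.
  by apply/differentiable_continuous/derivable1_diffP.
have h0 : Some (h w0) = chart (g p) (g p).
  by rewrite -(nbhs_singleton gh) /w0 -chart_finite chartK.
split.
  move=> A gA; suff : nbhs (chart p p) [set y | A (g (chart p y))].
    move=> /(@chart_continuous p p) nA.
    have {}nA : nbhs p (chart p @^-1` [set y | A (g (chart p y))]) by [].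
    by apply: filterS nA => x /=; rewrite chartK.
  rewrite chart_finite; apply/nbhs_Some.
  have : nbhs (chart (g p) (Some (h w0))) A by rewrite h0 chartK.
  move=> /(@chart_continuous (g p) (Some (h w0)))/nbhs_Some/hc nA.
  have {}nA : nbhs w0 (h @^-1` (Some @^-1` (chart (g p) @^-1` A))) by [].
  apply: filterS2 gh nA.
  by move=> w /= <-; rewrite chartK.
by apply: near_eq_derivable dh; move: gh; apply: filterS => w ->.
Qed.

Lemma holomorphic_cst (b : S) (U : set S) : holomorphic_on U (cst b).
Proof.
move=> p _; apply: (@holomorphic_at_chart _ _ (cst (finite_part (chart b b)))).
  exact: derivable_cst.
by near do exact: chart_finite.
Unshelve. all: by end_near. Qed.

Lemma derivable_hornerC (Q : {poly R[i]}) (z : C) :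
  derivable (fun w : C => Q.[w] : C) z 1.
Proof.
elim/poly_ind: Q => [|Q a IH].
  under eq_fun do rewrite horner0; exact: derivable_cst.
under eq_fun do rewrite hornerMXaddC.
by apply: derivableD; [apply: derivableM; [|exact: derivable_id]|exact: derivable_cst].
Qed.

(** Reversing the coefficients turns w^d Q(1/w) into a polynomial, defined at 0 as well, as the
    chart at infinity requires. *)
Lemma reverse_poly (Q : {poly R[i]}) : exists2 P : {poly R[i]},
  P.[0] = lead_coef Q & forall w, w != 0 -> P.[w] = w ^+ (size Q).-1 * Q.[w^-1].
Proof.
exists (\poly_(i < (size Q).-1.+1) Q`_((size Q).-1 - i)).
  by rewrite horner_coef0 coef_poly subn0.
move=> w w0; rewrite horner_poly (reindex_inj rev_ord_inj) /=.
rewrite (horner_coef_wide _ (leqSpred _)) mulr_sumr; apply: eq_bigr => i _.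
have id : (i <= (size Q).-1)%N by rewrite -ltnS.
rewrite subSS subKn // mulrCA; congr (_ * _).
by rewrite exprVn -expfB_cond // (negbTE w0).
Qed.

Lemma holomorphic_poly_map (Q : {poly R[i]}) p :
  (1 < size Q)%N -> holomorphic_at (poly_map Q) p.
Proof.
move=> Q1; case: p => [z|].
  apply: (@holomorphic_at_chart _ _ (horner Q)); first exact: derivable_hornerC.
  by near=> w.
have [P P0 PE] := reverse_poly Q.
have Q0 : lead_coef Q != 0 by rewrite lead_coef_eq0 -size_poly_gt0 (ltn_trans _ Q1).
(* In the chart at infinity [Q] reads 1/Q(1/w) = w^d / P(w), and P(0) is the nonzero leading
   coefficient. *)
apply: (@holomorphic_at_chart _ _ (fun w : C => 'X^((size Q).-1).[w] / P.[w])).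
  apply: derivableM; first exact: derivable_hornerC.
  by apply: derivableV; [rewrite /= P0|exact: derivable_hornerC].
have Pn0 : \forall w \near (0 : C), P.[w] != 0.
  have : {for (0 : C), continuous (fun w : C => P.[w] : C)}.
    by exact/differentiable_continuous/derivable1_diffP/derivable_hornerC.
  by move/cvgr_neq0; apply; rewrite P0.
apply: filterS Pn0 => w Pw; rewrite /= leqNgt Q1 /=.
(* Infinity is sent to infinity, so the quotient must vanish at 0; it does because the degree is
   positive. *)
have [->|w0] := eqVneq w 0.
  by rewrite /= leqNgt Q1 /= hornerXn expr0n -subn1 subn_eq0 [(_ <= 1)%N]leqNgt Q1 mul0r.
move: Pw; rewrite PE // mulf_eq0 negb_or => /andP[_ Qw] /=.
rewrite (negbTE Qw) hornerXn; congr Some.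
by rewrite invfM mulrA divff ?mul1r // expf_neq0.
Unshelve. all: by end_near. Qed.

Lemma poly_map_continuous (Q : {poly R[i]}) :
  (1 < size Q)%N -> continuous (poly_map Q).
Proof. by move=> Q1 p; have [] := holomorphic_poly_map p Q1. Qed.

(** The plane has no isolated points, so punctured neighbourhoods meet the complement of any finite
    set; infinity is treated through the inversion. *)
Lemma nbhs_fin_notin p (W : set S) (rs : seq R[i]) :
  nbhs p W -> exists2 w, w \notin rs & W (Some w).
Proof.
have avoid (z : C) (s : seq C) : z^' [set w | w \notin s].
  elim: s => [|a s IH]; first by apply: filterS filterT.
  have za : z^' [set w | w != a].
    have [->|za] := eqVneq z a; first exact: (@nbhs_dnbhs_neq C a).
    apply: nbhs_dnbhs; apply/nbhs_normsq; exists (normsq (a - z)).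
      by rewrite lt_neqAle normsq_ge0 eq_sym normsq_eq0 subr_eq0 eq_sym za.
    by move=> w; apply: contraTneq => ->; rewrite ltxx.
  by apply: filterS2 IH za => w; rewrite /= inE negb_or => -> ->.
case: p => [z|] pW.
  have zW : (z : C)^' [set w : C | W (Some w)].
    by apply: nbhs_dnbhs; apply/nbhs_Some.
  by have [w []] := filter_ex (filterI (avoid z rs) zW); exists w.
have zW : (0 : C)^' [set w : C | W (inversion (Some w))].
  have : nbhs (Some 0 : S) (@inversion R @^-1` W).
    by apply/inversion_continuous; rewrite /= eqxx.
  by move/nbhs_Some => iW; apply: nbhs_dnbhs.
(* Avoiding 0 makes the inversion of [Some w] finite; avoiding the inverses of [rs] keeps it off
   [rs]. *)
have [w []] := filter_ex (filterI (avoid 0 (0 :: map GRing.inv rs)) zW).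
rewrite /= inE negb_or => /andP[/negbTE -> wr] Ww.
by exists w^-1 => //; rewrite -(mem_map invr_inj) invrK.
Qed.

(** * Scaling by powers of two *)

Definition scale (t : int) x : S := omap (fun z => 2 ^ t * z) x.

Lemma poly_map_scale (t : int) (Q : {poly R[i]}) x :
  (1 < size Q)%N -> poly_map (2 ^ t *: Q) x = scale t (poly_map Q x).
Proof.
move=> Q1; have t0 : (2 : R[i]) ^ t != 0 by rewrite expfz_neq0 ?pnatr_eq0.
by case: x => [z|] /=; rewrite ?hornerZ // size_scale // leqNgt Q1.
Qed.

Lemma scaleD (s t : int) x : scale s (scale t x) = scale (s + t) x.
Proof.
by case: x => [z|] //=; rewrite mulrA -expfzDr ?pnatr_eq0.
Qed.

Lemma scale_fixed (t : int) x : x = Some 0 \/ x = None -> scale t x = x.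
Proof. by case=> -> //=; rewrite mulr0. Qed.

Lemma inversion_scale (t : int) x :
  inversion (scale t x) = scale (- t) (inversion x).
Proof.
have t0 : (2 : R[i]) ^ t != 0 by rewrite expfz_neq0 ?pnatr_eq0.
case: x => [z|] /=; last by rewrite mulr0.
rewrite mulf_eq0 (negbTE t0) /=; case: eqVneq => //= z0.
by rewrite invfM -invr_expz.
Qed.

(** For a = |z|^2 the hypothesis gives d <= 2a, while the image has chordal value 2 / (4^n a + 1) to
    infinity. The threshold depends on [e] and [d] alone, so the convergence is uniform away from
    0. *)
Lemma scale_to_infinity (e d : R) : 0 < e -> 0 < d -> exists T : nat,
  forall t : int, T%:Z <= t -> forall x, d <= chordal x (Some 0) ->
  chordal (scale t x) None < e.
Proof.
(* Since n <= 4^n, this threshold forces 4^n d e > 4, hence 4^n a e > 2. *)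
move=> e0 d0; exists (Num.bound (4 / (d * e))) => -[n|//] /= nT x dx.
have n4 : 4 / (d * e) < n%:R.
  apply: lt_le_trans (archi_boundP _) _.
    by rewrite divr_ge0 ?mulr_ge0 ?(ltW e0) ?(ltW d0).
  by rewrite ler_nat -lez_nat.
case: x dx => [z|_]; last by rewrite /chordal stereo_unit subrr.
rewrite chordal_fin chordal_inf subr0 normsqM.
have -> : normsq (0 : R[i]) = 0 by apply/eqP; rewrite normsq_eq0.
set a := normsq z; have a0 : 0 <= a := normsq_ge0 z.
have -> : normsq (2 ^ n%:Z : R[i]) = 4 ^+ n.
  elim: n {nT n4} => [|n IH]; first by rewrite expr0z normsq1.
  by rewrite exprSz normsqM IH exprS /normsq /=; congr (_ * _); ring.
rewrite add0r mulr1 ler_pdivlMr ?ltr_wpDl // => h.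
have n4n : n%:R <= 4 ^+ n :> R.
  by rewrite -natrX ler_nat ltnW // ltn_expl.
rewrite ltr_pdivrMr ?ltr_wpDl ?mulr_ge0 ?exprn_ge0 //.
move: n4; rewrite ltr_pdivrMr ?mulr_gt0 // => n4.
set X : R := 4 ^+ n in n4n *.
have : 4 < X * (d * e)
  by apply: lt_le_trans n4 _; rewrite ler_wpM2r ?mulr_ge0 ?(ltW e0) ?(ltW d0).
have : d <= 2 * a by nra.
move=> da hX; have : X * (d * e) <= X * (2 * a * e).
  by rewrite ler_wpM2l ?exprn_ge0 // ler_wpM2r // ltW.
by nra.
Qed.

(** The inversion exchanges 0 and infinity isometrically and negates the exponent, which reduces
    this to the limit at infinity. *)
Lemma scale_to_zero (e d : R) : 0 < e -> 0 < d -> exists T : nat,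
  forall t : int, t <= - T%:Z -> forall x, d <= chordal x None ->
  chordal (scale t x) (Some 0) < e.
Proof.
move=> e0 d0; have [T hT] := scale_to_infinity e0 d0; exists T => t tT x.
have i0 : inversion (Some 0) = None :> S by rewrite /= eqxx.
rewrite -chordal_inversion => dx; rewrite -chordal_inversion inversion_scale i0.
by apply: hT; rewrite // lerNr.
Qed.

(** * Locally uniform limits and failure of normality *)

(** Continuity of [F] keeps a neighbourhood of [p] at positive distance from [a], where the first
    hypothesis is a uniform estimate. *)
Lemma locally_uniform_cvg_cst (U : set S) (F : S -> S) (g : nat -> S -> S)
    (a b : S) :
  (forall e d : R, 0 < e -> 0 < d -> exists N, forall k, (N <= k)%N ->
     forall x, d <= chordal x a -> chordal (g k x) b < e) ->
  (forall p, U p -> {for p, continuous F} /\ F p <> a) ->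
  locally_uniform_cvg U (fun k => g k \o F) (cst b).
Proof.
move=> gb UF p /UF[Fp Fpa].
have s0 : 0 < sigma (F p) a.
  rewrite lt_neqAle acos_ge0 ?dot3_stereo_bound // andbT eq_sym.
  by apply/eqP => /sigma_eq0.
(* Moving [F p] by less than half its distance to [a] leaves the other half; [d] is the chordal
   counterpart of that half. *)
have e0 : 0 < sigma (F p) a / 2 by rewrite divr_gt0.
have [d d0 dP] := chordal_sigma e0.
exists (F @^-1` [set y | d <= chordal y a]).
  apply: Fp; apply/nbhs_ballP; exists (sigma (F p) a / 2) => // y /= py.
  rewrite leNgt; apply/negP => /dP ya.
  by have := sigma_triangle y (F p) a; move: py; rewrite /ball /=; lra.
move=> P /uniform_nbhs[E [entE EP]].
move: entE; rewrite -entourage_ballE => -[e /= e1 eE].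
have [d' d'0 d'P] := chordal_sigma e1.
have [N NP] := gb d' d d'0 d0.
exists N => // k /= Nk; apply: EP => y [_ /= dy]; apply: eE => /=.
by rewrite /ball /= sigma_sym; apply: d'P; exact: NP.
Qed.

Lemma increasing_geid (phi : nat -> nat) k : increasing_seq phi -> (k <= phi k)%N.
Proof.
move=> /increasing_seqP phiS; elim: k => // k IH.
exact: leq_ltn_trans IH (phiS k).
Qed.

(** A subsequential limit [h] would be continuous with [h p = a], yet equal to [b] at points
    arbitrarily close to [p]. *)
Lemma not_normal_on (A : set (S -> S)) (V : set S) p (a b : S) (g : nat -> S -> S) :
  open V -> V p -> (forall k, A (g k)) -> (forall k, g k p = a) -> a <> b ->
  (forall W, nbhs p W -> exists2 x, W x & g k x @[k --> \oo] --> b) ->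
  ~ normal_on V A.
Proof.
move=> oV Vp Ag gp ab gW /(_ g Ag)[phi [phiI [h [hV cvh]]]].
have ptw x : V x -> g (phi k) x @[k --> \oo] --> h x.
  move=> Vx; have [W xW cvW] := cvh x Vx.
  have : {uniform [set x], (g \o phi) @ \oo --> h}.
    by apply: uniform_subset_cvg cvW => _ ->; split => //; exact: nbhs_singleton.
  by rewrite uniform_set1.
have hS : hausdorff_space S := @metric_hausdorff R S.
have hp : h p = a.
  have := ptw p Vp; under eq_fun do rewrite gp.
  by move=> cv; apply: (cvg_unique hS cv); exact: cvg_cst.
have [hc _] := hV p Vp.
have ab0 : 0 < sigma a b.
  rewrite lt_neqAle acos_ge0 ?dot3_stereo_bound // andbT eq_sym.
  by apply/eqP => /sigma_eq0.
(* The ball of radius [sigma a b] about [a] misses [b]. *)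
have nW : nbhs p (V `&` h @^-1` ball a (sigma a b)).
  apply: filterI; first exact: open_nbhs_nbhs.
  by apply: hc; rewrite hp; exact: nbhsx_ballx.
have [x [Vx hx] gx] := gW _ nW.
suff hb : h x = b by move: hx; rewrite /= hb /ball /= ltxx.
have phicvg : phi @ \oo --> \oo.
  move=> P [N _ NP]; exists N => // k /= Nk; apply: NP => /=.
  exact: leq_trans Nk (increasing_geid _ phiI).
by apply: (cvg_unique hS (ptw x Vx)); exact: cvg_comp phicvg gx.
Qed.

(** * Subsequences of integer sequences *)

(** The index is positive because the family of iterates starts at 1. *)
Definition unbounded_above (t : nat -> int) :=
  forall T : nat, exists2 n, (0 < n)%N & T%:Z <= t n.

Definition unbounded_below (t : nat -> int) :=
  forall T : nat, exists2 n, (0 < n)%N & t n <= - T%:Z.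

Lemma infinite_subseq (P : nat -> Prop) :
  (forall N, exists2 k, (N <= k)%N & P k) ->
  exists phi : nat -> nat, increasing_seq phi /\ forall k, P (phi k).
Proof.
move=> infP; have /choice[f fP] : forall N, exists k, (N <= k)%N /\ P k.
  by move=> N; have [k] := infP N; exists k.
exists (fix phi k := if k is j.+1 then f (phi j).+1 else f 0%N); split.
  by apply/increasing_seqP => n /=; exact: (fP _.+1).1.
by case=> [|k]; exact: (fP _).2.
Qed.

(** If no value recurs infinitely often, |u k| tends to infinity. Then either infinitely many terms
    are nonnegative and form a subsequence tending to +oo, or a whole tail is negative and tends to
    -oo. *)
Lemma int_subseq (u : nat -> int) :
  exists phi : nat -> nat, increasing_seq phi /\
  [\/ exists c, forall k, u (phi k) = c,
      forall T : nat, exists N, forall k, (N <= k)%N -> T%:Z <= u (phi k) |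
      forall T : nat, exists N, forall k, (N <= k)%N -> u (phi k) <= - T%:Z].
Proof.
have [[c /infinite_subseq[phi [phiI uc]]]|nc] :=
    pselect (exists c, forall N, exists2 k, (N <= k)%N & u k = c).
  by exists phi; split => //; constructor 1; exists c.
have far (c : int) : exists N, forall k, (N <= k)%N -> u k <> c.
  apply: contra_notP nc => /forallNP nc; exists c => N.
  apply: contra_notP (nc N) => nk k Nk ukc; apply: nk.
  by exists k.
have {}far (T : nat) : exists N, forall k, (N <= k)%N -> (T <= `|u k|)%N.
  elim: T => [|T [N NT]]; first by exists 0%N.
  (* Once |u k| >= T, excluding the values T and -T gives |u k| >= T + 1. *)
  have [N1 N1T] := far T%:Z; have [N2 N2T] := far (- T%:Z).
  exists (maxn N (maxn N1 N2)) => k; rewrite !geq_max => /and3P[Nk N1k N2k].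
  by have := NT k Nk; have := N1T k N1k; have := N2T k N2k; lia.
have [pos|] := pselect (forall N, exists2 k, (N <= k)%N & 0 <= u k).
  have [phi [phiI uP]] := infinite_subseq pos.
  exists phi; split => //; constructor 2 => T; have [N NT] := far T.
  exists N => k Nk; have := NT _ (leq_trans Nk (increasing_geid k phiI)).
  by have := uP k; lia.
move=> /existsNP[N0 npos]; exists (addn N0); split.
  by apply/increasing_seqP => n; rewrite addnS; exact: ltnSn.
constructor 3 => T; have [N NT] := far T; exists N => k Nk.
have := NT _ (leq_trans Nk (leq_addl N0 k)).
suff : u (N0 + k)%N < 0 by lia.
by rewrite ltNge; apply/negP => uk; apply: npos; exists (N0 + k)%N; rewrite ?leq_addr.
Qed.

(** * The Julia set of the scaled compositions *)

Lemma is_julia_set_scale (f : nat -> S -> S) (t : nat -> int) (Q : {poly R[i]}) :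
  (1 < size Q)%N ->
  (forall n, (0 < n)%N -> iterate f n = scale (t n) \o poly_map Q) ->
  is_julia_set f [set x | (poly_map Q x = Some 0 /\ unbounded_above t) \/
                          (poly_map Q x = None /\ unbounded_below t)].
Proof.
move=> Q1 fE; set J := [set x | _].
have Qc : continuous (poly_map Q) := poly_map_continuous Q1.
exists (~` J); last by rewrite setCK.
split.
- rewrite openC.
  (* [J] is the preimage of at most two points under a continuous map, hence closed. *)
  pose D : set S := [set y | (y = Some 0 /\ unbounded_above t) \/
                             (y = None /\ unbounded_below t)].
  have -> : J = poly_map Q @^-1` D by [].
  apply: preimage_closed; first by move=> x _; exact: Qc.
  apply: (accessible_finite_set_closed.1 (hausdorff_accessible (@metric_hausdorff R S))).
  apply: (@sub_finite_set _ _ [set Some 0; None]); last exact: finite_set2.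
  by move=> y [[-> _]|[-> _]]; [left|right].
- move=> g gf; have /choice[m mP] : forall k, exists m,
      (0 < m)%N /\ g k = scale (t m) \o poly_map Q.
    by move=> k; have [m /= m0 <-] := gf k; exists m; rewrite fE.
  have gE phi : g \o phi = (fun k => scale (t (m (phi k))) \o poly_map Q).
    by apply/funext => k /=; have [] := mP (phi k).
  (* The given sequence of iterates may repeat or reorder indices, so the trichotomy is applied to
     its exponents [t (m k)]. *)
  have [phi [phiI]] := int_subseq (t \o m).
  case=> [[c tc]|tT|tT]; exists phi; split => //; rewrite gE.
  + exists (poly_map (2 ^ c *: Q)); split.
      move=> p _; apply: holomorphic_poly_map.
      by rewrite size_scale // expfz_neq0 ?pnatr_eq0.
    have -> : poly_map (2 ^ c *: Q) = scale c \o poly_map Q.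
      by apply/funext => x; rewrite poly_map_scale.
    move=> p _; exists setT; first exact: filterT.
    have -> : (fun k => scale (t (m (phi k))) \o poly_map Q) =
        cst (scale c \o poly_map Q).
      by apply/funext => k; rewrite -(tc k).
    by move=> P nP; exists 0%N => // k _; exact: nbhs_singleton nP.
  + exists (cst None); split; first exact: holomorphic_cst.
    apply: (locally_uniform_cvg_cst (g := fun k => scale (t (m (phi k)))) (a := Some 0)).
      move=> e d e0 d0; have [T TP] := scale_to_infinity e0 d0.
      by have [N NP] := tT T; exists N => k /NP; exact: TP.
    move=> p Jp; split; first exact: Qc.
    (* If [Q] vanished at [p], the exponents along the subsequence would put [p] in [J]. *)
    move=> Qp; apply: Jp; left; split => // T; have [N NP] := tT T.
    by exists (m (phi N)); [have [] := mP (phi N)|exact: NP].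
  + exists (cst (Some 0)); split; first exact: holomorphic_cst.
    apply: (locally_uniform_cvg_cst (g := fun k => scale (t (m (phi k)))) (a := None)).
      move=> e d e0 d0; have [T TP] := scale_to_zero e0 d0.
      by have [N NP] := tT T; exists N => k /NP; exact: TP.
    move=> p Jp; split; first exact: Qc.
    move=> Qp; apply: Jp; right; split => // T; have [N NP] := tT T.
    by exists (m (phi N)); [have [] := mP (phi N)|exact: NP].
- move=> V oV nV p Vp.
  have Q0 : Q != 0 by rewrite -size_poly_gt0 (ltn_trans _ Q1).
  have itf n : (0 < n)%N -> iterates f (scale (t n) \o poly_map Q).
    by move=> n0; exists n => //; rewrite fE.
  (* [Q] has finitely many zeros and is finite at finite points, so arbitrarily near [p] there are
     points that the scalings move to the opposite pole. *)
  have near_p W : nbhs p W ->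
      exists2 x, W x & poly_map Q x <> Some 0 /\ poly_map Q x <> None.
    have [rs QE] := closed_field_poly_normal Q.
    have rsP w : w \notin rs -> Q.[w] != 0.
      apply: contraNN; rewrite -rootE QE rootZ ?lead_coef_eq0 //.
      by rewrite root_prod_XsubC.
    move=> /(nbhs_fin_notin rs)[w wr Ww]; exists (Some w) => //=.
    by split => // -[] Qw; have := rsP w wr; rewrite Qw eqxx.
  have ne (a b : S) : a <> b -> 0 < chordal a b.
    move=> ab; rewrite lt_neqAle chordal_ge0 andbT eq_sym.
    by apply/eqP => /chordal_eq0.
  case=> [[Qp tT]|[Qp tT]].
  + have /choice[n nP] : forall k : nat, exists n, (0 < n)%N /\ k%:Z <= t n.
      by move=> k; have [n] := tT k; exists n.
    apply: (not_normal_on (a := Some 0) (b := None)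
        (g := fun k => scale (t (n k)) \o poly_map Q) oV Vp) nV => //.
    * by move=> k; apply: itf; have [] := nP k.
    * by move=> k; rewrite /= Qp scale_fixed //; left.
    * move=> W /near_p[x Wx [Qx0 _]]; exists x => //.
      apply/cvg_ballP => e e0; have [d d0 dP] := chordal_sigma e0.
      have [T TP] := scale_to_infinity d0 (ne _ _ Qx0).
      exists T => // k /= Tk; rewrite /ball /= sigma_sym; apply: dP.
      by apply: TP => //; apply: le_trans (nP k).2.
  + have /choice[n nP] : forall k : nat, exists n, (0 < n)%N /\ t n <= - k%:Z.
      by move=> k; have [n] := tT k; exists n.
    apply: (not_normal_on (a := None) (b := Some 0)
        (g := fun k => scale (t (n k)) \o poly_map Q) oV Vp) nV => //.
    * by move=> k; apply: itf; have [] := nP k.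
    * by move=> k; rewrite /= Qp scale_fixed //; right.
    * move=> W /near_p[x Wx [_ Qx0]]; exists x => //.
      apply/cvg_ballP => e e0; have [d d0 dP] := chordal_sigma e0.
      have [T TP] := scale_to_zero d0 (ne _ _ Qx0).
      exists T => // k /= Tk; rewrite /ball /= sigma_sym; apply: dP.
      by apply: TP => //; apply: le_trans (nP k).2 _; rewrite lerN2.
Qed.

(** * Realization of a prescribed finite set *)

Lemma poly_mapX x : poly_map ('X : {poly R[i]}) x = x.
Proof. by case: x => [z|] /=; rewrite ?hornerX // size_polyX. Qed.

Lemma exists_julia_set (t : nat -> int) (Q : {poly R[i]}) : (1 < size Q)%N ->
  exists q : nat -> {poly R[i]}, is_julia_set (fun n => poly_map (q n))
    [set x | (poly_map Q x = Some 0 /\ unbounded_above t) \/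
             (poly_map Q x = None /\ unbounded_below t)].
Proof.
move=> Q1.
pose q n := if (n <= 1)%N then 2 ^ t n *: Q else 2 ^ (t n - t n.-1) *: 'X.
exists q; apply: is_julia_set_scale => // -[//|n] _; elim: n => [|n IH].
  by apply/funext => x; rewrite /= /q poly_map_scale.
apply/funext => x; have -> : iterate (fun n => poly_map (q n)) n.+2 x =
    poly_map (q n.+2) (iterate (fun n => poly_map (q n)) n.+1 x) by [].
by rewrite IH /q /= poly_map_scale ?size_polyX // poly_mapX scaleD subrK.
Qed.

Lemma finite_julia_set (E : set S) : finite_set E ->
  exists q : nat -> {poly R[i]}, is_julia_set (fun n => poly_map (q n)) E.
Proof.
move=> /finite_seqP[s Es]; pose rs := pmap id s.
have rsE z : (z \in rs) = (Some z \in s) by rewrite mem_pmap map_id.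
(* An empty product would be constant, so ['X] replaces it; the exponents below are then bounded
   above, which keeps its zero out of the Julia set. *)
pose Q : {poly R[i]} := if rs is [::] then 'X else \prod_(z <- rs) ('X - z%:P).
have Q1 : (1 < size Q)%N.
  rewrite /Q; case: (rs) => [|z l]; first by rewrite size_polyX.
  by rewrite size_prod_XsubC.
(* On odd (resp. even) indices the exponents force finite points (resp.
   infinity) into the Julia set, if required. *)
pose t n : int := if odd n then (if rs is [::] then 0 else n%:Z)
                  else (if None \in s then - n%:Z else 0).
have [q qJ] := exists_julia_set t Q1; exists q.
suff -> : E = [set x | (poly_map Q x = Some 0 /\ unbounded_above t) \/
                       (poly_map Q x = None /\ unbounded_below t)] by [].
have tinf : unbounded_below t <-> None \in s.
  split=> [/(_ 1%N)[n n0]|sN T].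
    by rewrite /t; case: (odd n) (None \in s) (rs) => [] [] [|? ?] //; lia.
  (* The successor keeps this even index positive when [T] is 0. *)
  by exists T.+1.*2 => //; rewrite /t odd_double sN -addnn; lia.
rewrite Es; apply/seteqP; split => [[z|]|[z|]] /=.
- rewrite -rsE => zs; left; split.
    rewrite /Q; case: (rs) zs => [//|a l] zs; congr Some; apply/eqP.
    by rewrite -rootE root_prod_XsubC.
  move=> T; exists T.*2.+1 => //; rewrite /t /= odd_double /=.
  by case: (rs) zs => // *; lia.
- by move=> /tinf tT; right; rewrite leqNgt Q1.
- case=> [[[Qz] tT]|[]//]; rewrite -rsE.
  (* With [rs] empty all exponents are at most 0, so the threshold 1 is never reached. *)
  have rs0 : rs <> [::].
    by move=> rs0; have [n _] := tT 1%N; rewrite /t rs0; do 2 case: ifP => //; lia.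
  have QE : Q = \prod_(a <- rs) ('X - a%:P) by rewrite /Q; case: (rs) rs0.
  by rewrite -root_prod_XsubC -QE rootE Qz.
- by case=> [[]|[_ /tinf]] //; rewrite leqNgt Q1.
Qed.

End Sphere.

Theorem theorem5p8 (R : realType) :
  (forall E : set (sphere R), finite_set E ->
     exists q : nat -> {poly R[i]}, is_julia_set (fun n => poly_map (q n)) E)
  /\
  (forall m : nat, exists (q : nat -> {poly R[i]}) (E : set (sphere R)),
     (E #= `I_m)%card /\ is_julia_set (fun n => poly_map (q n)) E).
Proof.
split=> [E|m]; first exact: finite_julia_set.
(* Natural numbers are distinct in characteristic zero, so the image of [I_m] has exactly m
   points. *)
pose f (k : nat) : sphere R := Some k%:R.
have fI : injective f by move=> j k [] /eqP; rewrite eqr_nat => /eqP.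
have [|q qJ] := @finite_julia_set R (f @` `I_m).
  exact/finite_image/finite_II.
exists q, (f @` `I_m); split => //.
by apply: inj_card_eq => j k _ _ /fI.
Qed.
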